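(* Let $\beta>0$ and let $\mathsf{ALG}$ be a $\beta$-nice algorithm with output size $k'=k$. Let $\{T_1,\dots,T_m\}$ be a random clustering of the ground set $\mathbb N$ into $m$ parts with multiplicity $1$ (i.e., each item is placed, independently, in exactly one of the $m$ parts chosen uniformly at random). Then: (i) if $f$ is a non-negative monotone submodular function, $\mathsf{ALG}$ is a $\frac{1}{2+\beta}$-approximate randomized composable core-set of multiplicity $1$ and size $k$ for $f$ and cardinality constraint $k$, i.e. $\mathbb E[f_k(\mathsf{ALG}(T_1)\cup\dots\cup\mathsf{ALG}(T_m))]\ge \frac{1}{2+\beta}\,\mathbb E[f_k(T_1\cup\dots\cup T_m)]$; (ii) if $f$ is a non-negative (not necessarily monotone) submodular function, $\mathsf{ALG}$ is a $\frac{1-\frac1m}{2+\beta}$-approximate randomized composable core-set of multiplicity $1$ and size $k$ for $f$ and cardinality constraint $k$.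
   Context: $\mathbb N$ is a finite ground set and $f:2^{\mathbb N}\to\mathbb R_{\ge 0}$. $f$ is monotone if $f(X)\le f(Y)$ for $X\subseteq Y$, and submodular if $f(X\cup\{x\})-f(X)\ge f(Y\cup\{x\})-f(Y)$ for all $X\subseteq Y\subseteq\mathbb N$, $x\in\mathbb N\setminus Y$. Write $\Delta(x,X)=f(X\cup\{x\})-f(X)$ and, for an integer $k$, $f_k(S)=\max_{S'\subseteq S,|S'|\le k}f(S')$. A random clustering of $\mathbb N$ into $m$ sets with multiplicity $C$ is a family $\{T_1,\dots,T_m\}$ where each item of $\mathbb N$ is independently assigned to $C$ randomly chosen (distinct) sets among the $m$. An algorithm $\mathsf{ALG}$ that, given any $T\subseteq\mathbb N$, returns $\mathsf{ALG}(T)\subseteq T$ with $|\mathsf{ALG}(T)|\le k'$ is an $\alpha$-approximate randomized composable core-set of size $k'$ and multiplicity $C$ for $f$ and cardinality constraint $k$ if $\mathbb E[f_k(\mathsf{ALG}(T_1)\cup\dots\cup\mathsf{ALG}(T_m))]\ge\alpha\,\mathbb E[f_k(T_1\cup\dots\cup T_m)]$, the expectation over the random clustering. Such an $\mathsf{ALG}$ (output size at most $k'$) is $\beta$-nice for $f$ if for every $T\subseteq\mathbb N$ and every $x\in T\setminus\mathsf{ALG}(T)$: (a) $\mathsf{ALG}(T\setminus\{x\})=\mathsf{ALG}(T)$, and (b) $\Delta(x,\mathsf{ALG}(T))\le\beta\,\frac{f(\mathsf{ALG}(T))}{k'}$. *)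

(* Defs.v *)
From HB Require Import structures.
From mathcomp Require Import all_boot all_order all_algebra.
From mathcomp Require Import reals.

Set Implicit Arguments.
Unset Strict Implicit.
Unset Printing Implicit Defensive.

Import Order.TTheory GRing.Theory Num.Theory.
Local Open Scope ring_scope.

Section SetFunctions.
Variables (R : realType) (N : finType).
Implicit Types (f : {set N} -> R) (X Y S T : {set N}) (x : N).

Definition nonnegative f : Prop := forall X, 0 <= f X.

Definition monotone f : Prop := forall X Y, X \subset Y -> f X <= f Y.

Definition marginal f x X : R := f (x |: X) - f X.

Definition submodular f : Prop :=
  forall X Y x, X \subset Y -> x \notin Y -> marginal f x Y <= marginal f x X.

(* The default value [f set0] does not alter the maximum, since [set0] always
   belongs to the range. *)
Definition fmax f (k : nat) S : R :=
  \big[Num.max/f set0]_(S' : {set N} | (S' \subset S) && (#|S'| <= k)%N) f S'.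

End SetFunctions.

Section RandomClustering.
Variables (R : realType) (N : finType) (m : nat).

(* [A x] is the set of (indices of) parts to which the item [x] is assigned. *)
Definition assignment := {ffun N -> {set 'I_m}}.

Definition part (A : assignment) (i : 'I_m) : {set N} := [set x | i \in A x].

(* The product law over the items of the uniform law on the [C]-subsets of the
   [m] parts.  It is a probability when [C <= m]. *)
Definition clustering_law (C : nat) (A : assignment) : R :=
  \prod_(x : N) (if #|A x| == C then ('C(m, C)%:R)^-1 else 0).

Definition clustering_expectation (C : nat) (X : assignment -> R) : R :=
  \sum_(A : assignment) clustering_law C A * X A.

End RandomClustering.

Section CoreSets.
Variables (R : realType) (N : finType).
Implicit Types (f : {set N} -> R) (ALG : {set N} -> {set N}).

Definition selects_at_most (k' : nat) ALG : Prop :=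
  forall T : {set N}, ALG T \subset T /\ (#|ALG T| <= k')%N.

(* For [k' = 0] the quotient below is [0]. *)
Definition nice (beta : R) (k' : nat) f ALG : Prop :=
  selects_at_most k' ALG /\
  forall (T : {set N}) (x : N), x \in T :\: ALG T ->
    ALG (T :\ x) = ALG T /\
    marginal f x (ALG T) <= beta * (f (ALG T) / k'%:R).

Definition randomized_composable_coreset
    (alpha : R) (m C k' k : nat) f ALG : Prop :=
  selects_at_most k' ALG /\
  alpha * clustering_expectation C
            (fun A : assignment N m => fmax f k (\bigcup_(i < m) part A i))
  <= clustering_expectation C
       (fun A : assignment N m => fmax f k (\bigcup_(i < m) ALG (part A i))).

End CoreSets.

(* Main.v *)
(** Let [O] be an optimal set, [S_i] the output of [ALG] on part [i], and [M] the
value of the best set of size at most [k] in the union of the [S_i].  Adding the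
items of [O] in a fixed order, [f O] exceeds [f] of the selected items of [O],
hence [M], by at most the sum of the marginals of the unselected ones.  For an
unselected [x] in part [i], split its marginal into its marginal after [S_i] has
been added, which niceness bounds by [beta * M / k], and the loss caused by
adding [S_i].  When [x] is not selected, [S_i] is also the output on part [i]
without [x], which is independent of whether [x] lies in part [i]: the losses
therefore contribute in expectation at most [1 / m] times the sum of all losses
over [x] and [i].  For fixed [i] these telescope to
[f O - f set0 - f (O :|: S_i) + f S_i]. *)

Require Import Defs.
From mathcomp Require Import all_boot all_order all_algebra.
From mathcomp Require Import reals.
From mathcomp Require Import perm lra.

Set Implicit Arguments.
Unset Strict Implicit.
Unset Printing Implicit Defensive.

Import Order.TTheory GRing.Theory Num.Theory.
Local Open Scope ring_scope.

(** * Telescoping sums and lattice inequalities for submodular functions *)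

Section SubmodularFunctions.
Variables (R : realType) (N : finType).
Implicit Types (f : {set N} -> R) (O S T X Y : {set N}) (x : N).

Definition before O x : {set N} :=
  [set y in O | (enum_rank y < enum_rank x)%N].

Lemma before_sub O x : before O x \subset O.
Proof. by apply/subsetP => y; rewrite inE => /andP[]. Qed.

Lemma before_notin O x : x \notin before O x.
Proof. by rewrite inE ltnn andbF. Qed.

Lemma beforeS O S x : O \subset S -> before O x \subset before S x.
Proof.
move=> /subsetP OS; apply/subsetP => y; rewrite !inE => /andP[yO ->].
by rewrite OS.
Qed.

(** Telescoping over the prefixes of [O], indexed by all ranks: a rank whose item lies outside [O]
    leaves the prefix unchanged. *)
Lemma sum_marginal_before f O S :
  \sum_(x in O) marginal f x (before O x :|: S) = f (O :|: S) - f S.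
Proof.
pose P n := [set y in O | (enum_rank y < n)%N].
have P0 : P 0%N = set0 by apply/setP => y; rewrite !inE ltn0 andbF.
have PN : P #|N| = O by apply/setP => y; rewrite inE ltn_ord andbT.
have := telescope_sumr (fun n => f (P n :|: S)) (leq0n #|N|).
rewrite P0 PN set0U big_mkord => <-.
rewrite big_mkcond (reindex_onto enum_val enum_rank) /=; last first.
  by move=> x _; rewrite enum_rankK.
rewrite (eq_bigl xpredT) => [|i]; last by rewrite enum_valK eqxx.
apply: eq_bigr => i _; rewrite /marginal.
have -> : before O (enum_val i) = P i.
  by apply/setP => y; rewrite !inE enum_valK.
have memPS y : (y \in P i.+1) = (y \in P i) || ((y == enum_val i) && (y \in O)).
  rewrite !inE ltnS leq_eqVlt andb_orr orbC; congr orb.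
  by rewrite -[y == _](inj_eq enum_rank_inj) enum_valK andbC.
case: ifP => iO.
  congr (f _ - _); apply/setP => y; rewrite setUA !in_setU memPS in_set1.
  by case: eqP => [->|_]; rewrite ?iO ?orbT ?orbF.
rewrite (_ : P i.+1 = P i) ?subrr //; apply/setP => y; rewrite memPS.
by case: eqP => [->|_]; rewrite ?iO orbF.
Qed.

(** Adding the items of [X :\: Y] one by one to [Y] gains at most what adding them to the smaller
    [X :&: Y] does. *)
Lemma submodular_setUI f X Y : submodular f ->
  f (X :|: Y) + f (X :&: Y) <= f X + f Y.
Proof.
move=> fs.
have e1 := sum_marginal_before f (X :\: Y) Y.
have e2 := sum_marginal_before f (X :\: Y) (X :&: Y).
have eU : f (X :|: Y) = f (X :\: Y :|: Y).
  by congr f; apply/setP => y; rewrite !inE; case: (y \in Y); rewrite ?orbT.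
have eX : f X = f (X :\: Y :|: X :&: Y) by rewrite setUC setID.
suff : f (X :\: Y :|: Y) - f Y <= f (X :\: Y :|: X :&: Y) - f (X :&: Y).
  by rewrite -eU -eX; lra.
rewrite -e1 -e2; apply: ler_sum => x; rewrite inE => /andP[xY _].
apply: fs; first by rewrite setUS ?subsetIr.
by rewrite in_setU negb_or before_notin.
Qed.

Lemma sum_marginal_before0 f O :
  \sum_(x in O) marginal f x (before O x) = f O - f set0.
Proof.
rewrite -[X in _ = f X - _]setU0 -sum_marginal_before.
by apply: eq_bigr => x _; rewrite setU0.
Qed.

(** Dropping from [before O x] the items outside [S] can only raise the marginals of the items of
    [O :&: S], which then telescope. *)
Lemma submodular_setI_ge f O S : submodular f ->
  f O - \sum_(x in O :\: S) marginal f x (before O x) <= f (O :&: S).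
Proof.
move=> fs; have := sum_marginal_before0 f O; rewrite (big_setID S) /=.
have := sum_marginal_before0 f (O :&: S).
have : \sum_(x in O :&: S) marginal f x (before O x) <=
    \sum_(x in O :&: S) marginal f x (before (O :&: S) x).
  by apply: ler_sum => x _; apply: fs; rewrite ?beforeS ?subsetIl ?before_notin.
lra.
Qed.

(** By disjointness, [O :|: F i] and the union of [O] with the later sets meet exactly in [O], so
    each induction step yields one more [f O]. *)
Lemma sum_setU_trivI f (I : finType) (F : I -> {set N}) O (r : seq I) :
  submodular f -> uniq r ->
  (forall i j, i != j -> [disjoint F i & F j]) ->
  f (O :|: \bigcup_(i <- r) F i) + (size r)%:R * f O
    <= \sum_(i <- r) f (O :|: F i) + f O.
Proof.
move=> fs + Fd; elim: r => [|i r IH] /=.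
  by rewrite !big_nil setU0 mul0r addr0 add0r.
move=> /andP[ir /IH {}IH]; rewrite !big_cons.
have := submodular_setUI (O :|: F i) (O :|: \bigcup_(j <- r) F j) fs.
rewrite -setUIr -setUUr.
have -> : F i :&: \bigcup_(j <- r) F j = set0.
  apply/eqP; rewrite setI_eq0; rewrite big_seq disjoint_sym.
  elim/big_rec: _ => [|j X jr Xd]; first by rewrite -setI_eq0 set0I.
  rewrite -setI_eq0 setIUl setU_eq0 !setI_eq0 Xd andbT Fd //.
  by apply: contraNneq ir => <-.
rewrite setU0 -natr1 mulrDl mul1r; lra.
Qed.

Lemma fmax_ge f k S O : O \subset S -> (#|O| <= k)%N -> f O <= fmax f k S.
Proof.
by move=> OS Ok; rewrite /fmax (le_bigmax_cond _ f) // OS.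
Qed.

Lemma fmax_attained f k S :
  exists2 O : {set N}, (O \subset S) && (#|O| <= k)%N & fmax f k S = f O.
Proof.
rewrite /fmax; elim/big_ind: _ => [|a b [X hX ->] [Y hY ->]|X hX].
- by exists set0; rewrite ?sub0set ?cards0.
- by case: (leP (f X) (f Y)) => _; [exists Y | exists X].
- by exists X.
Qed.

End SubmodularFunctions.

(** * Expectation over random partitions *)

Section Expectation.
Variables (R : realType) (N : finType) (m : nat).
Local Notation E := (@clustering_expectation R N m 1).
Implicit Types (X Y : assignment N m -> R) (A : assignment N m).

Definition is_partition A := forall x, #|A x| = 1%N.

Lemma clustering_law_ge0 C A : 0 <= clustering_law R C A.
Proof. by apply: prodr_ge0 => x _; case: ifP => // _; rewrite invr_ge0. Qed.

(** Lets expectations be compared on genuine partitions only. *)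
Lemma clustering_law1_support A :
  is_partition A \/ clustering_law R 1 A = 0.
Proof.
case: (boolP [forall x, #|A x| == 1%N]) => [/forallP H|].
  by left => x; apply/eqP.
rewrite negb_forall => /existsP[x /negbTE xA]; right.
by rewrite /clustering_law (bigD1 x) //= xA mul0r.
Qed.

Lemma expectation_le X Y :
  (forall A, is_partition A -> X A <= Y A) -> E X <= E Y.
Proof.
move=> XY; apply: ler_sum => A _.
case: (clustering_law1_support A) => [/XY|->]; last by rewrite !mul0r.
exact/ler_wpM2l/clustering_law_ge0.
Qed.

Lemma expectation_eq X Y :
  (forall A, is_partition A -> X A = Y A) -> E X = E Y.
Proof.
by move=> XY; apply/le_anti/andP; split; apply: expectation_le => A /XY ->.
Qed.

Lemma expectationD X Y : E (fun A => X A + Y A) = E X + E Y.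
Proof. by rewrite -big_split; apply: eq_bigr => A _; rewrite mulrDr. Qed.

Lemma expectationZ a X : E (fun A => a * X A) = a * E X.
Proof. by rewrite mulr_sumr; apply: eq_bigr => A _; rewrite mulrCA. Qed.

Lemma expectation_sum (I : finType) (P : pred I) (F : I -> assignment N m -> R) :
  E (fun A => \sum_(i | P i) F i A) = \sum_(i | P i) E (F i).
Proof. by rewrite exchange_big; apply: eq_bigr => A _; rewrite mulr_sumr. Qed.

(* Exchanging the names of two parts for the item [x] alone preserves the law,
   so all parts are equally likely to receive [x], given the other items. *)
Lemma expectation_decouple x (i : 'I_m) X :
  (forall A B : assignment N m, (forall y, y != x -> A y = B y) -> X A = X B) ->
  m%:R * E (fun A => (i \in A x)%:R * X A) = E X.
Proof.
move=> Xx.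
have swap j : E (fun A => (j \in A x)%:R * X A) = E (fun A => (i \in A x)%:R * X A).
  pose s A : assignment N m :=
    [ffun y => if y == x then tperm i j @: A y else A y].
  have sK : involutive s.
    move=> A; apply/ffunP => y; rewrite !ffunE; case: eqP => // _.
    rewrite -imset_comp -[RHS]imset_id; apply: eq_imset => z /=.
    by rewrite tpermK.
  rewrite /clustering_expectation (reindex_inj (inv_inj sK)) /=.
  apply: eq_bigr => A _; congr (_ * (_%:R * _)).
  - apply: eq_bigr => y _; rewrite ffunE; case: (y == x) => //.
    by rewrite card_imset //; apply: perm_inj.
  - by rewrite ffunE eqxx -{1}(tpermL i j) mem_imset //; apply: perm_inj.
  - by apply: Xx => y /negbTE yx; rewrite ffunE yx.
(* Exactly one part holds [x], so these [m] equal expectations add up to [E X]. *)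
transitivity (\sum_(j < m) E (fun A => (j \in A x)%:R * X A)).
  by rewrite (eq_bigr _ (fun j _ => swap j)) sumr_const card_ord mulr_natl.
rewrite -expectation_sum; apply: expectation_eq => A /(_ x) Ax.
rewrite -mulr_suml -natr_sum (_ : (\sum_(j < m) (j \in A x))%N = #|A x|).
  by rewrite Ax mul1r.
by rewrite -sum1_card [RHS]big_mkcond; apply: eq_bigr => j _; case: ifP.
Qed.

Lemma bigcup_part A : is_partition A -> \bigcup_(i < m) part A i = setT.
Proof.
move=> Ap; apply/setP => x; rewrite inE; apply/bigcupP.
have /card_gt0P[i iA] : (0 < #|A x|)%N by rewrite Ap.
by exists i => //; rewrite inE.
Qed.

Lemma part_inj A i j x :
  is_partition A -> x \in part A i -> x \in part A j -> i = j.
Proof.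
by move=> /(_ x)/eqP/cards1P[l Al]; rewrite !inE Al !inE => /eqP-> /eqP->.
Qed.

End Expectation.

(** * Bounding the optimum by the value of the core-set *)

Section CoreSetBound.
Variables (R : realType) (N : finType) (f : {set N} -> R).
Variables (beta : R) (k m : nat) (ALG : {set N} -> {set N}).
Hypotheses (m_gt0 : (0 < m)%N) (beta_gt0 : 0 < beta).
Hypotheses (f_ge0 : nonnegative f) (f_submod : submodular f).
Hypothesis ALG_nice : nice beta k f ALG.
Variable O : {set N}.
Hypotheses (O_card : (#|O| <= k)%N) (O_max : fmax f k setT = f O).

Implicit Types (A : assignment N m) (i : 'I_m) (x : N) (S T : {set N}).

Local Notation E := (@clustering_expectation R N m 1).

Let union A := \bigcup_(i < m) ALG (part A i).
Let M A := fmax f k (union A).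

Let loss x S := marginal f x (before O x) - marginal f x (before O x :|: S).

(* On the event that [x] lies in part [i] and is not selected there, this is
   [loss x (ALG (part A i))]; but its value does not depend on [A x]. *)
Let decoupled x i A :=
  if x \in ALG (x |: part A i) then 0 else loss x (ALG (part A i :\ x)).

Lemma ALG_notin_setU1 x T : x \notin ALG (x |: T) ->
  ALG T = ALG (x |: T) /\ ALG (T :\ x) = ALG (x |: T).
Proof.
move=> xT; have [_ /(_ (x |: T) x)[]] := ALG_nice.
  by rewrite !inE xT eqxx.
rewrite setDUl setDv set0U => e _; split => //.
case: (boolP (x \in T)) => xT'; first by rewrite (setUidPr _) ?sub1set.
by rewrite -e; congr ALG; apply/esym/setDidPl; rewrite disjoint_sym disjoints1.
Qed.

(* Optimality of [O] replaces monotonicity here: [O :\ x] is feasible, so [x]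
   has nonnegative marginal on it, hence also on the smaller [before O x]. *)
Lemma marginal_before_ge0 x : x \in O -> 0 <= marginal f x (before O x).
Proof.
move=> xO; apply: (@le_trans _ _ (marginal f x (O :\ x))).
  rewrite subr_ge0 setD1K // -O_max fmax_ge ?subsetT //.
  by rewrite (leq_trans _ O_card) ?subset_leq_card ?subsetDl.
apply: f_submod; last by rewrite !inE eqxx.
by rewrite subsetD1 before_sub before_notin.
Qed.

(** For [x] in [S] the second marginal vanishes and optimality of [O] concludes; otherwise
    submodularity does. *)
Lemma loss_ge0 x S : x \in O -> 0 <= loss x S.
Proof.
move=> xO; rewrite subr_ge0; have [xS|xS] := boolP (x \in S).
  rewrite {1}/marginal (setUidPr _) ?subrr ?marginal_before_ge0 //.
  by rewrite sub1set inE xS orbT.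
by apply: f_submod; rewrite ?subsetUl // in_setU negb_or before_notin.
Qed.

Lemma sum_loss S :
  \sum_(x in O) loss x S = f O - f set0 - (f (O :|: S) - f S).
Proof.
by rewrite sumrB sum_marginal_before sum_marginal_before0.
Qed.

Lemma decoupled_le x i A : x \in O -> decoupled x i A <= loss x (ALG (part A i)).
Proof.
move=> xO; rewrite /decoupled; case: ifPn => [_|/ALG_notin_setU1[-> ->]] //.
exact: loss_ge0.
Qed.

Lemma decoupled_ge0 x i A : x \in O -> 0 <= decoupled x i A.
Proof. by move=> xO; rewrite /decoupled; case: ifP => // _; apply: loss_ge0. Qed.

Lemma ALG_part_le i A : f (ALG (part A i)) <= M A.
Proof.
have [/(_ (part A i))[_ c] _] := ALG_nice.
by apply: fmax_ge; rewrite // (bigcup_sup i).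
Qed.

Lemma M_ge0 A : 0 <= M A.
Proof.
by rewrite /M; have [X _ ->] := fmax_attained f k (union A); apply: f_ge0.
Qed.

(* Niceness bounds the marginal of [x] on [before O x :|: ALG (part A i)]. *)
Lemma marginal_unselected_le x i A :
  is_partition A -> x \in part A i -> x \notin union A ->
  marginal f x (before O x) <= decoupled x i A + beta * (M A / k%:R).
Proof.
move=> Ap xi xU.
have xS : x \notin ALG (part A i).
  by apply: contra xU => xS; apply/bigcupP; exists i.
have [_ /(_ (part A i) x)[]] := ALG_nice; first by rewrite inE xS.
move=> e le_x; rewrite /decoupled (setUidPr _) ?sub1set // (negbTE xS) e /loss.
rewrite -addrA lerDl addrC subr_ge0.
apply: (@le_trans _ _ (marginal f x (ALG (part A i)))).
  by apply: f_submod; rewrite ?subsetUr // in_setU negb_or before_notin.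
apply: (le_trans le_x); rewrite ler_pM2l // ler_wpM2r ?invr_ge0 //.
exact: ALG_part_le.
Qed.

Lemma optimum_le A : is_partition A ->
  f O <= (1 + beta) * M A +
         \sum_(x in O) \sum_(i < m) (i \in A x)%:R * decoupled x i A.
Proof.
move=> Ap; have := submodular_setI_ge O (union A) f_submod.
have MI : f (O :&: union A) <= M A.
  rewrite fmax_ge ?subsetIr // (leq_trans _ O_card) //.
  by rewrite subset_leq_card ?subsetIl.
pose D x := \sum_(i < m) (i \in A x)%:R * decoupled x i A.
have D_ge0 x : x \in O -> 0 <= D x.
  by move=> xO; apply: sumr_ge0 => i _; rewrite mulr_ge0 ?decoupled_ge0.
have le1 : \sum_(x in O :\: union A) marginal f x (before O x) <=
    \sum_(x in O :\: union A) (D x + beta * (M A / k%:R)).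
  apply: ler_sum => x; rewrite inE => /andP[xU xO].
  have : x \in \bigcup_(i < m) part A i by rewrite bigcup_part ?inE.
  case/bigcupP => i _ xi.
  apply: le_trans (marginal_unselected_le Ap xi xU) _.
  rewrite lerD2r /D (bigD1 i) //=.
  have -> : i \in A x by rewrite inE in xi.
  rewrite mul1r lerDl sumr_ge0 // => j _.
  by rewrite mulr_ge0 ?decoupled_ge0.
have le2 : \sum_(x in O :\: union A) D x <= \sum_(x in O) D x.
  rewrite [leRHS](big_setID (union A)) /= lerDr sumr_ge0 //.
  by move=> x /setIP[/D_ge0].
have le3 : \sum_(x in O :\: union A) beta * (M A / k%:R) <= beta * M A.
  rewrite sumr_const -mulrnAr ler_pM2l // -[leLHS]mulr_natr.
  (* For [k = 0] the quotient is [0] by convention, and [0 <= M A] remains. *)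
  have [->|k0] := posnP k; first by rewrite invr0 mulr0 mul0r M_ge0.
  rewrite mulrAC ler_pdivrMr ?ltr0n // ler_wpM2l ?M_ge0 // ler_nat.
  by rewrite (leq_trans _ O_card) ?subset_leq_card ?subsetDl.
rewrite [leRHS]big_split /= in le1 => le0.
by suff: f O <= (1 + beta) * M A + \sum_(x in O) D x by []; lra.
Qed.

(* Monotonicity gives the hypothesis with [c = 1]; for general [f], disjointness
   of the selected sets gives it with [c = 1 - 1 / m]. *)
Lemma coreset_bound c :
  (forall A, is_partition A ->
     m%:R * c * f O <= \sum_(i < m) f (O :|: ALG (part A i))) ->
  randomized_composable_coreset (c / (2 + beta)) m 1 k k f ALG.
Proof.
move=> cO; split; first by case: ALG_nice.
rewrite (@expectation_eq _ _ _ _ (fun=> f O)); last first.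
  by move=> A Ap; rewrite bigcup_part.
have m0 : 0 < m%:R :> R by rewrite ltr0n.
have b2 : 0 < 2 + beta by rewrite addr_gt0.
(* This is [optimum_le] in expectation, times [m]: decoupling absorbs that factor and removes the
   indicators. *)
have le1 : m%:R * E (fun=> f O) <=
    m%:R * (1 + beta) * E M +
    E (fun A => \sum_(x in O) \sum_(i < m) decoupled x i A).
  have -> : E (fun A => \sum_(x in O) \sum_(i < m) decoupled x i A) =
      m%:R * E (fun A =>
        \sum_(x in O) \sum_(i < m) (i \in A x)%:R * decoupled x i A).
    rewrite !(@expectation_sum _ _ _ _ (mem O)) mulr_sumr.
    apply: eq_bigr => x _; rewrite !(@expectation_sum _ _ _ _ xpredT) mulr_sumr.
    apply: eq_bigr => i _; rewrite expectation_decouple // => A B AB.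
    have e : part A i :\ x = part B i :\ x.
      by apply/setP => y; rewrite !inE; case: eqP => // /eqP/AB ->.
    have U1D1 T : x |: T = x |: (T :\ x).
      by apply/setP => y; rewrite !inE; case: eqP.
    by rewrite /decoupled U1D1 e -U1D1.
  rewrite -mulrA -mulrDr ler_pM2l // -expectationZ -expectationD.
  by apply: expectation_le => A Ap; exact: optimum_le.
have le2 : E (fun A => \sum_(x in O) \sum_(i < m) decoupled x i A) <=
    E (fun A => m%:R * (1 - c) * f O + m%:R * M A).
  apply: expectation_le => A Ap.
  apply: (@le_trans _ _ (\sum_(i < m) \sum_(x in O) loss x (ALG (part A i)))).
    rewrite exchange_big; apply: ler_sum => i _; apply: ler_sum => x.
    exact: decoupled_le.
  apply: (@le_trans _ _ (\sum_(i < m) ((f O + M A) - f (O :|: ALG (part A i))))).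
    apply: ler_sum => i _; rewrite sum_loss.
    have := ALG_part_le i A; have := f_ge0 set0; lra.
  rewrite sumrB sumr_const card_ord -mulr_natl; have := cO A Ap; lra.
rewrite expectationD (expectationZ m%:R) in le2.
have e : E (fun=> m%:R * (1 - c) * f O) = m%:R * (1 - c) * E (fun=> f O).
  by rewrite -expectationZ.
rewrite {}e in le2.
(* Together [le1] and [le2] give [c * E (fun=> f O) <= (2 + beta) * E M], up to the factor [m]. *)
rewrite mulrAC ler_pdivrMr // -(ler_pM2l m0).
lra.
Qed.

End CoreSetBound.

Theorem theorem1 (R : realType) (N : finType) (f : {set N} -> R)
    (beta : R) (k m : nat) (ALG : {set N} -> {set N})
    (m_gt0 : (0 < m)%N) (beta_gt0 : 0 < beta)
    (f_ge0 : nonnegative f) (f_submod : submodular f)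
    (ALG_nice : nice beta k f ALG) :
  (monotone f ->
     randomized_composable_coreset (1 / (2 + beta)) m 1 k k f ALG) /\
  randomized_composable_coreset ((1 - 1 / m%:R) / (2 + beta)) m 1 k k f ALG.
Proof.
have [O /andP[_ O_card] O_max] := fmax_attained f k setT.
split=> [f_mono|]; apply: (coreset_bound _ _ _ _ _ O_card O_max) => // A Ap.
  rewrite mulr1 mulr_natl -[X in _ *+ X]card_ord -sumr_const.
  by apply: ler_sum => i _; rewrite f_mono ?subsetUl.
have Fd i j : i != j -> [disjoint ALG (part A i) & ALG (part A j)].
  have [sel _] := ALG_nice.
  apply: contraNT => /pred0Pn[x /andP[xi xj]]; apply/eqP.
  by apply: (part_inj Ap (x := x)); apply: (subsetP (sel _).1).
(* As the union term is nonnegative, the sum is at least [(m - 1) * f O], which is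
   [m * (1 - 1 / m) * f O]. *)
have := sum_setU_trivI O f_submod (enum_uniq 'I_m) Fd.
rewrite !big_enum /= size_enum_ord.
have := f_ge0 (O :|: \bigcup_(i < m) ALG (part A i)).
rewrite mulrBr mulr1 mulrA mulr1 divff ?pnatr_eq0 -?lt0n //; lra.
Qed.
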